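(* Let $M$ be a matroid of rank $d+1$ on the ground set $\{0,\dots,n\}$ (not necessarily representable over any field), and let $\Sigma$ be the fine subdivision on the Bergman fan $\operatorname{trop}(M)$ in $\mathbb{R}^n \cong \mathbb{R}^{n+1}/\mathbb{R}\mathbf{1}$. Then the facet-ridge hypergraph of $\Sigma$ is $d$-connected.
   Context: Here $\mathbf{1} = (1,\dots,1) \in \mathbb{R}^{n+1}$, and $\mathbf{e}_0,\dots,\mathbf{e}_n$ is the standard basis of $\mathbb{R}^{n+1}$. For a subset $F \subseteq \{0,\dots,n\}$ write $\mathbf{e}_F = \sum_{i\in F}\mathbf{e}_i$. The fine subdivision of the Bergman fan of a loopless matroid $M$ of rank $d+1$ on $\{0,\dots,n\}$ is the polyhedral fan in $\mathbb{R}^{n+1}/\mathbb{R}\mathbf{1}$ whose cones are the images of $\operatorname{pos}(\mathbf{e}_{F_1},\dots,\mathbf{e}_{F_k})$ (the set of nonnegative linear combinations), one for each chain $\emptyset \subsetneq F_1 \subsetneq \cdots \subsetneq F_k \subsetneq \{0,\dots,n\}$ of flats of $M$ with $k \ge 0$ (the empty chain giving the origin). It is the cone over a geometric realization of the order complex of the proper part of the lattice of flats; it is a pure $d$-dimensional pointed simplicial fan, and its support is the Bergman fan $\operatorname{trop}(M)$. (If $M$ has a loop, the Bergman fan is empty.) Connectivity: the facets and ridges of a pure $d$-dimensional polyhedral complex are its faces of dimension $d$ and $d-1$, respectively. The facet-ridge hypergraph has the facets as vertices and the ridges as hyperedges, the hyperedge of a ridge $\tau$ being the set of facets containing $\tau$.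 A hypergraph is connected if there is a path from any vertex to any other vertex in which each step connects two vertices in the same hyperedge. A hypergraph is $k$-connected if it remains connected after any $k-1$ vertices and all hyperedges incident to them are removed (a hyperedge containing a removed vertex is deleted entirely). *)

(* Defs.v *)
From HB Require Import structures.
From mathcomp Require Import all_boot all_order all_algebra.
From mathcomp Require Import boolp classical_sets functions cardinality reals.

Set Implicit Arguments.
Unset Strict Implicit.
Unset Printing Implicit Defensive.

Import Order.TTheory GRing.Theory Num.Theory.
Local Open Scope ring_scope.
Local Open Scope classical_set_scope.

Record matroid (T : finType) := Matroid {
  indep : pred {set T};
  indep0 : indep finset.set0;
  indepS : forall A B : {set T}, A \subset B -> indep B -> indep A;
  indep_aug : forall A B : {set T}, indep A -> indep B -> (#|A| < #|B|)%N ->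
    exists2 x, x \in (B :\: A)%SET & indep (x |: A)%SET }.

Section MatroidNotions.
Variables (T : finType) (M : matroid T).

Definition rank (A : {set T}) : nat :=
  \max_(I : {set T} | (I \subset A) && indep M I) #|I|.

Definition flat (F : {set T}) : bool :=
  [forall x, (x \notin F) ==> (rank F < rank (x |: F)%SET)%N].

Definition loopless : bool := [forall x, indep M [set x]%SET].

(* c = [:: F_1; ...; F_k] with  set0 < F_1 < ... < F_k < setT, all F_i flats;
   set0 and setT themselves are not part of the chain. *)
Definition flat_chain (c : seq {set T}) : bool :=
  all flat c &&
  path (fun A B : {set T} => A \proper B) finset.set0 (rcons c [set: T]%SET).

End MatroidNotions.

Section Cones.
Variable R : realType.

Definition pos (V : lmodType R) (X : seq V) : set V :=
  [set v | exists2 a : 'I_(size X) -> R,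
     forall i, 0 <= a i & v = \sum_(i < size X) a i *: X`_i].

Section Dimension.
Variable V : vectType R.

Definition is_lin_hull (C : set V) (U : {vspace V}) : Prop :=
  (forall v, C v -> v \in U) /\
  (forall W : {vspace V}, (forall v, C v -> v \in W) -> (U <= W)%VS).

Definition lin_hull (C : set V) : {vspace V} := xget 0%VS (is_lin_hull C).

Lemma lin_hullP (C : set V) : is_lin_hull C (lin_hull C).
Proof.
suff [U CU] : exists U, is_lin_hull C U by rewrite /lin_hull; apply: xgetPex; exists U.
pose P k := `[< exists2 U : {vspace V}, \dim U = k & forall v, C v -> v \in U >].
have exP : exists k, P k.
  by exists (\dim {:V}); apply/asboolP; exists fullv => // v _; exact: memvf.
case: (ex_minnP exP) => k /asboolP[U dU CU] kmin.
exists U; split=> // W CW; apply/capv_idPl/eqP.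
rewrite eqEdim capvSl dU kmin//; apply/asboolP; exists (U :&: W)%VS => // v Cv.
by rewrite memv_cap CU// CW.
Qed.

(* A cone contains the origin, so its affine hull is its linear hull. *)
Definition cone_dim (C : set V) : nat := \dim (lin_hull C).

End Dimension.
End Cones.

Section Hypergraphs.
Variable T : Type.

Record hypergraph := Hypergraph { hverts : set T; hedges : set (set T) }.

Definition hadj (H : hypergraph) (x y : T) : Prop :=
  exists2 e, hedges H e & e x /\ e y.

Definition hconnected (H : hypergraph) : Prop :=
  forall x y, hverts H x -> hverts H y ->
    exists2 p : seq T, path (fun u v => `[< hadj H u v >]) x p & last x p = y.

(* A hyperedge meeting S is deleted, not shrunk. *)
Definition hremove (H : hypergraph) (S : set T) : hypergraph :=
  Hypergraph (hverts H `\` S) [set e | hedges H e /\ e `&` S = classical_sets.set0].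

(* Fewer than k vertices, i.e. at most k - 1 of them, are removed. *)
Definition hkconnected (k : nat) (H : hypergraph) : Prop :=
  forall (S : set T) (m : nat),
    S `<=` hverts H -> (S #= `I_m)%card -> (m < k)%N -> hconnected (hremove H S).

End Hypergraphs.

Section FacetRidge.
Variables (R : realType) (V : vectType R) (d : nat) (Sigma : set (set V)).

Definition facets : set (set V) := [set C | Sigma C /\ cone_dim C = d].

(* Dimension d - 1; there is no ridge when d = 0. *)
Definition ridges : set (set V) := [set C | Sigma C /\ (cone_dim C).+1 = d].

Definition facet_ridge_hypergraph : hypergraph (set V) :=
  Hypergraph facets
    [set [set C | facets C /\ tau `<=` C] | tau in ridges].

End FacetRidge.

Section BergmanFan.
Variables (R : realType) (n : nat).

(* The isomorphism R^(n+1) / R1 -> R^n, [x] |-> (x_1 - x_0, ..., x_n - x_0). *)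
Definition quot1 (x : 'rV[R]_n.+1) : 'rV[R]_n :=
  \row_(i < n) (x ord0 (lift ord0 i) - x ord0 ord0).

Lemma quot1_linear : linear quot1.
Proof. by move=> a x y; apply/rowP => i; rewrite !mxE mulrBr opprD addrACA. Qed.

Lemma quot1_eq0 (x : 'rV[R]_n.+1) :
  quot1 x = 0 <-> exists a : R, x = a *: const_mx 1.
Proof.
split=> [/rowP x0|[a ->]]; last by apply/rowP => i; rewrite !mxE subrr.
exists (x ord0 ord0); apply/rowP => j; rewrite !mxE mulr1.
case: (unliftP ord0 j) => [i ->|-> //].
by have := x0 i; rewrite !mxE => /eqP; rewrite subr_eq0 => /eqP.
Qed.

Lemma quot1_surj (y : 'rV[R]_n) : exists x, quot1 x = y.
Proof.
exists (\row_j if unlift ord0 j is Some i then y ord0 i else 0).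
by apply/rowP => i; rewrite !mxE liftK unlift_none subr0.
Qed.

Definition e_ (F : {set 'I_n.+1}) : 'rV[R]_n.+1 := \sum_(i in F) delta_mx ord0 i.

Definition chain_cone (c : seq {set 'I_n.+1}) : set 'rV[R]_n :=
  quot1 @` pos [seq e_ F | F <- c].

(* The Bergman fan of a matroid with a loop is empty. *)
Definition fine_subdivision (M : matroid 'I_n.+1) : set (set 'rV[R]_n) :=
  [set C | loopless M /\ exists2 c, flat_chain M c & C = chain_cone c].

End BergmanFan.

Arguments fine_subdivision R {n} M.

(* Main.v *)
Require Import Defs.
From HB Require Import structures.
From mathcomp Require Import all_boot all_order all_algebra.
From mathcomp Require Import boolp classical_sets functions cardinality reals.
From Stdlib Require Import Relation_Operators.

(** A facet of the fine subdivision is the cone over a full flag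
    [F_1 < ... < F_d] of proper nonempty flats, a ridge is the cone over a chain
    of [d - 1] such flats, and inclusion of cones is inclusion of chains, because
    the ray of a flat [F] lies in the cone over a chain only if [F] belongs to
    that chain ([chain_cone_ray]).  So the theorem is about full flags: after
    deletion of a set [S] of fewer than [d] of them, any two others are linked
    by steps along ridges that are contained in no deleted flag.

    This is proved by induction on [d] ([full_flags_linked]), for full flags
    above an arbitrary flat [F], so that the flags through a cover [A] of [F]
    (its star) are an instance of the same problem with [d - 1] in place of [d].
    - Call [A] good if at most [d - 2] deleted flags pass through it.  The star
      of a good cover is connected by induction.
    - Two covers [A], [B] span a line [L], a flat covering both.  Any ridge
      [L < F_3 < ...] contained in no deleted flag joins the stars of [A] and
      [B].  At least [d - 1] ridges start with [L], and a deleted flag contains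
      just one ridge that skips the first rank; as there are at most [d - 1]
      deleted flags, all the ridges are lost for at most one line.  If that line
      is [L], a cover [E] not below it serves as an intermediate stop, since the
      lines spanned by [A], [E] and by [E], [B] differ from [L].
    - If [A] is not good, then all the deleted flags pass through [A].  A
      surviving flag [A < F_2 < ...] moves to [B < F_2 < ...] for another cover
      [B] below [F_2]; no deleted flag contains the ridge [F_2 < ...], as the
      only such flag through [A] is the surviving one.  Every other cover is
      good, so the previous case applies.
    For [d = 1] nothing is deleted, and the empty ridge is in all the facets. *)

Set Implicit Arguments.
Unset Strict Implicit.
Unset Printing Implicit Defensive.

(** * Flats of a matroid *)

Section Flats.
Import fintype boot.finset.
Local Open Scope set_scope.
Variables (T : finType) (M : matroid T).
Implicit Types (A B C F L I J K : {set T}) (x y : T).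
Local Notation rank := (rank M).

Lemma indep_le_rank I A : indep M I -> I \subset A -> #|I| <= rank A.
Proof.
move=> iI sIA; by rewrite /Defs.rank (bigmax_sup I) // sIA.
Qed.

Lemma rank_le A k :
  (forall I, indep M I -> I \subset A -> #|I| <= k) -> rank A <= k.
Proof. by move=> h; apply/bigmax_leqP => I /andP[sIA iI]; apply: h. Qed.

Lemma rankS A B : A \subset B -> rank A <= rank B.
Proof.
move=> sAB; apply: rank_le => I iI sIA.
by apply: indep_le_rank => //; apply: subset_trans sAB.
Qed.

Lemma basis_extend I A : indep M I -> I \subset A ->
  exists J, [/\ I \subset J, J \subset A, indep M J & #|J| = rank A].
Proof.
move=> iI sIA.
pose P J := [&& I \subset J, J \subset A & indep M J].
have PI : P I by rewrite /P subxx sIA.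
case: (arg_maxnP (fun J : {set T} => #|J|) PI) => J /and3P[sIJ sJA iJ] Jmax.
exists J; split=> //; apply/eqP; rewrite eqn_leq indep_le_rank//=.
apply: rank_le => K iK sKA; rewrite leqNgt; apply/negP => ltJK.
have [x /setDP[xK xJ] ixJ] := indep_aug iJ iK ltJK.
have := Jmax (x |: J); rewrite /P ixJ subUset sub1set (subsetP sKA) // sJA.
rewrite (subset_trans sIJ (subsetUr _ _)) cardsU1 xJ.
by move=> h; have := h isT; rewrite /= add1n ltnn.
Qed.

Lemma basis_exists A :
  exists I, [/\ I \subset A, indep M I & #|I| = rank A].
Proof.
have [J [_ sJA iJ cJ]] := basis_extend (indep0 M) (sub0set A).
by exists J.
Qed.

Lemma rankU1 x A : rank (x |: A) <= (rank A).+1.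
Proof.
apply: rank_le => I iI sI.
have : #|I :\ x| <= rank A.
  apply: indep_le_rank; first exact: indepS (subD1set _ _) iI.
  by rewrite subDset.
by move=> h; rewrite (cardsD1 x I) -add1n leq_add // leq_b1.
Qed.

Lemma rank_flat_lt F A : flat M F -> F \proper A -> rank F < rank A.
Proof.
move=> /forallP fF /properP[sFA [x xA xF]].
apply: leq_trans (implyP (fF x) xF) (rankS _).
by rewrite subUset sub1set xA.
Qed.

(** Flats are closed: the new element [y] would have to augment a basis of [F]
    that extends a basis of [A], making the rank of [A] jump. *)
Lemma flat_closed F A y : flat M F -> A \subset F ->
  rank (y |: A) = rank A -> y \in F.
Proof.
move=> /forallP fF sAF ryA; apply/negPn/negP => yF.
have {fF} := implyP (fF y) yF.
have [I [sIA iI cI]] := basis_exists A.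
have [J [sIJ sJF iJ cJ]] := basis_extend iI (subset_trans sIA sAF).
have [K [sK iK cK]] := basis_exists (y |: F).
rewrite -cJ -cK => ltJK.
have [k /setDP[kK kJ] ikJ] := indep_aug iJ iK ltJK.
have := subsetP sK _ kK; rewrite !inE => /orP[/eqP kE|kF]; last first.
  have : #|k |: J| <= rank F.
    by apply: indep_le_rank => //; rewrite subUset sub1set kF.
  by rewrite cardsU1 kJ -cJ ltnn.
subst k; have : #|y |: I| <= rank (y |: A).
  by apply: indep_le_rank; [apply: indepS (setUS _ sIJ) ikJ | apply: setUS].
by rewrite cardsU1 (contra (subsetP sIJ y) kJ) ryA cI ltnn.
Qed.

Lemma flat_sub F A C : flat M F -> A \subset F -> A \subset C ->
  rank C = rank A -> C \subset F.
Proof.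
move=> fF sAF sAC rC; apply/subsetP => y yC; apply: (flat_closed fF sAF).
apply/eqP; rewrite eqn_leq -{1}rC !rankS ?subsetUr//.
by rewrite subUset sub1set yC.
Qed.

Definition flat_hull A := [set x | rank (x |: A) == rank A].

Lemma sub_flat_hull A : A \subset flat_hull A.
Proof. by apply/subsetP => x xA; rewrite inE (setUidPr _) ?sub1set. Qed.

Lemma rank_flat_hull A : rank (flat_hull A) = rank A.
Proof.
apply/eqP; rewrite eqn_leq (rankS (sub_flat_hull A)) andbT.
have [I [sIA iI cI]] := basis_exists A.
apply: rank_le => J iJ sJ; rewrite leqNgt -cI; apply/negP => ltIJ.
have [x /setDP[xJ xI] ixI] := indep_aug iI iJ ltIJ.
have := subsetP sJ x xJ; rewrite inE => /eqP rx.
have : #|x |: I| <= rank (x |: A) by apply: indep_le_rank => //; apply: setUS.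
by rewrite cardsU1 xI rx cI ltnn.
Qed.

Lemma flat_flat_hull A : flat M (flat_hull A).
Proof.
apply/forallP => x; apply/implyP => xA; rewrite rank_flat_hull.
apply: (@leq_trans (rank (x |: A))); last by rewrite rankS ?setUS ?sub_flat_hull.
by move: xA; rewrite inE ltn_neqAle eq_sym => ->; rewrite rankS ?subsetUr.
Qed.

Definition covers F A := [&& flat M A, F \proper A & rank A == (rank F).+1].

(** The last clause is what puts two covers of [F] below a common line. *)
Lemma covers_through F x : flat M F -> x \notin F -> exists A,
  [/\ covers F A, x \in A &
      forall L, flat M L -> F \subset L -> x \in L -> A \subset L].
Proof.
move=> fF xF; have sA := sub_flat_hull (x |: F).
have xA : x \in flat_hull (x |: F) by rewrite (subsetP sA) ?setU11.
exists (flat_hull (x |: F)); split=> // [|L fL sFL xL]; last first.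
  apply: (flat_sub fL _ sA (rank_flat_hull _)).
  by rewrite subUset sub1set xL.
apply/and3P; split; first exact: flat_flat_hull.
  apply/properP; split; first exact: subset_trans (subsetUr _ _) sA.
  by exists x.
rewrite rank_flat_hull eqn_leq rankU1/=.
exact: (implyP (forallP fF x) xF).
Qed.

Lemma covers_eq F A B : covers F A -> covers F B -> A \subset B -> A = B.
Proof.
move=> /and3P[fA _ /eqP rA] /and3P[fB _ /eqP rB] sAB; apply/eqP.
rewrite eqEproper sAB; apply/negP => /(rank_flat_lt fA).
by rewrite rA rB ltnn.
Qed.

Lemma covers_line F A B L : covers F A -> covers A L -> covers F B ->
  B \subset L -> covers B L.
Proof.
move=> /and3P[_ _ /eqP rA] /and3P[fL _ /eqP rL] /and3P[_ _ /eqP rB] sBL.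
rewrite /covers fL rL rA rB eqxx andbT properEneq sBL andbT.
by apply/eqP => eBL; move: rL; rewrite -eBL rA rB => /n_Sn.
Qed.

(** For [x] in [B] but not in [A], the line is the cover of [A] through [x]; it
    contains [B], which is the least flat that contains [F] and [x]. *)
Lemma covers_join F A B : flat M F -> covers F A -> covers F B -> A != B ->
  exists2 L, covers A L & covers B L.
Proof.
move=> fF cA cB nAB; have /and3P[fA pFA _] := cA; have /and3P[fB pFB _] := cB.
have /subsetPn[x xB xA] : ~~ (B \subset A).
  apply: contra nAB => sBA; exact/eqP/esym/(covers_eq cB cA).
have [L [cL xL _]] := covers_through fA xA; exists L => //.
apply: (covers_line cA cL cB); have /and3P[fL pAL _] := cL.
have [C [cC xC Cmin]] :=
  covers_through fF (contra (subsetP (proper_sub pFA) x) xA).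
rewrite -(covers_eq cC cB) ?Cmin ?proper_sub //.
exact: proper_trans pFA pAL.
Qed.
End Flats.

(** * Connectivity of full flags *)

Section Flags.
Import fintype boot.finset.
Local Open Scope set_scope.
Variables (T : finType) (M : matroid T).
Implicit Types (A B F L : {set T}) (c r s x y z : seq {set T}).
Local Notation rank := (rank M).
Local Notation flat := (flat M).
Local Notation psub := (fun A B : {set T} => A \proper B).
Local Notation cov := (covers M).

(** The flag starts above an arbitrary [F], so that the tail of a flag over [F]
    is a flag over its first member; over the empty set this is [flat_chain]. *)
Definition flag_over F c := all flat c && path psub F (rcons c [set: T]).

Lemma flag_cons F A c :
  flag_over F (A :: c) = [&& flat A, F \proper A & flag_over A c].
Proof. by rewrite /flag_over /= -!andbA; do !bool_congr. Qed.

Lemma psub_trans : transitive psub.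
Proof. by move=> B A C; apply: proper_trans. Qed.

Lemma flag_sorted F c : flag_over F c -> sorted psub (F :: c).
Proof. by move=> /andP[_] /=; rewrite rcons_path => /andP[]. Qed.

Lemma flag_uniq F c : flag_over F c -> uniq (F :: c).
Proof.
by move=> /flag_sorted; apply: (sorted_uniq psub_trans) => A; apply: properxx.
Qed.

Lemma flag_eq F F' c c' : flag_over F c -> flag_over F' c' ->
  size c <= size c' -> {subset c' <= c} -> c = c'.
Proof.
move=> fc fc' hs sub.
have /andP[_ uc] := flag_uniq fc; have /andP[_ uc'] := flag_uniq fc'.
have [_ eqm] := uniq_min_size uc' sub hs.
have sc := path_sorted (flag_sorted fc).
have sc' := path_sorted (flag_sorted fc').
by apply: (irr_sorted_eq psub_trans _ sc sc') => // A; apply: properxx.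
Qed.

Lemma flag_mem_proper F c A : flag_over F c -> A \in c -> F \proper A.
Proof.
move=> /flag_sorted /= /(order_path_min psub_trans) /allP h Ac; exact: h.
Qed.

Lemma flag_mem_properT F c A : flag_over F c -> A \in c -> A \proper [set: T].
Proof.
move=> /andP[_ /path_sorted]; elim: c => //= B c IHc.
rewrite (path_sortedE psub_trans) all_rcons inE => /andP[/andP[BT _] sc].
by move=> /orP[/eqP->|] //; apply: IHc.
Qed.

Lemma flag_rank F c : flat F -> flag_over F c ->
  rank F + size c < rank [set: T].
Proof.
elim: c F => [|A c IHc] F fF.
  by rewrite /flag_over /= andbT addn0; apply: rank_flat_lt.
rewrite flag_cons => /and3P[fA pFA /(IHc _ fA)].
by apply: leq_ltn_trans; rewrite /= addnS -addSn leq_add2r; apply: rank_flat_lt.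
Qed.

(** [F] is a flat over which the longest flags have [k] members. *)
Definition corank F k := flat F && (rank F + k.+1 == rank [set: T]).

Lemma corank_covers F A k : corank F k.+1 -> cov F A -> corank A k.
Proof.
by case/andP=> _ /eqP rF /and3P[fA _ /eqP rA];
  rewrite /corank fA rA -rF addSnnS /=.
Qed.

(** There is no room to skip a rank: by [flag_rank], if [A] were further up then
    [c] would be too long for a flag over [A]. *)
Lemma full_flag_cons F A c : corank F (size c).+1 ->
  flag_over F (A :: c) = cov F A && flag_over A c.
Proof.
move=> /andP[fF /eqP rF]; rewrite flag_cons.
apply/and3P/andP => [[fA pFA fc]|[/and3P[fA pFA _] fc]]; split=> //.
rewrite /covers fA pFA eqn_leq rank_flat_lt // andbT /=.
by have := flag_rank fA fc; rewrite -rF !addnS ltnS -addSn leq_add2r.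
Qed.

Lemma full_flag_exists F k : corank F k ->
  exists2 c, flag_over F c & size c = k.
Proof.
elim: k F => [|k IHk] F cF; have /andP[fF /eqP rF] := cF.
  exists [::] => //; rewrite /flag_over /= andbT properT.
  by apply/eqP => eF; move: rF; rewrite eF addn1 => /esym/n_Sn.
have /subsetPn[x _ xF] : ~~ ([set: T] \subset F).
  by apply/negP => /(rankS M); rewrite -rF leqNgt addnS ltnS leq_addr.
have [A [cA _ _]] := covers_through fF xF.
have [c fc sc] := IHk A (corank_covers cF cA).
by exists (A :: c); rewrite /= ?sc // full_flag_cons ?sc // cA.
Qed.

Lemma covers_off F B k : corank F k.+1 -> rank B < rank [set: T] ->
  F \subset B -> exists2 A, cov F A & ~~ (A \subset B).
Proof.
move=> /andP[fF _] rB sFB.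
have /subsetPn[x _ xB] : ~~ ([set: T] \subset B).
  by apply/negP => /(rankS M); rewrite leqNgt rB.
have [A [cA xA _]] := covers_through fF (contra (subsetP sFB x) xB).
by exists A => //; apply/subsetPn; exists x.
Qed.

Lemma corank_rank_lt F k : corank F k -> rank F < rank [set: T].
Proof. by case/andP=> _ /eqP <-; rewrite addnS ltnS leq_addr. Qed.

(** Induction: all but one of the flags pass through one cover of [F], and the
    last one passes through another cover. *)
Lemma many_full_flags F k : corank F k -> exists Z, [/\ uniq Z, size Z = k.+1 &
  forall z, z \in Z -> flag_over F z /\ size z = k].
Proof.
elim: k F => [|k IHk] F cF.
  have [z fz sz] := full_flag_exists cF.
  by exists [:: z]; split=> // _ /[1!inE] /eqP->.
have /andP[fF _] := cF.
have [A cA _] := covers_off cF (corank_rank_lt cF) (subxx F).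
have cfA := corank_covers cF cA; have /and3P[_ pFA _] := cA.
have [B cB nBA] := covers_off cF (corank_rank_lt cfA) (proper_sub pFA).
have [Z [uZ sZ ZP]] := IHk A cfA.
have [z fz sz] := full_flag_exists (corank_covers cF cB).
exists ((B :: z) :: map (cons A) Z); split.
- rewrite /= map_inj_uniq ?uZ ?andbT; last by move=> ? ? [].
  by apply/mapP => -[y _ [eBA _]]; rewrite eBA subxx in nBA.
- by rewrite /= size_map sZ.
move=> y; rewrite inE => /orP[/eqP->|/mapP[w /ZP[fw sw] ->]].
  by rewrite /= sz full_flag_cons ?sz ?cB.
by rewrite /= sw full_flag_cons ?sw ?cA.
Qed.

Implicit Type S : seq (seq {set T}).

(** The ridge [r] is a hyperedge that survives the deletion of the vertices in
    [S] when no member of [S] contains it. *)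
Definition flag_adj k F S x y := exists r,
  [/\ [/\ flag_over F x, size x = k.+1, flag_over F y & size y = k.+1],
      flag_over F r /\ size r = k, {subset r <= x}, {subset r <= y} &
      forall s, s \in S -> ~ {subset r <= s}].

Definition flag_linked k F S := clos_refl_trans _ (flag_adj k F S).

Lemma flag_linked_sym k F S x y :
  flag_linked k F S x y -> flag_linked k F S y x.
Proof.
elim=> {x y} [x y [r [[fx sx fy sy] fr rx ry rS]]|x|x y z _ yx _ zy].
- by apply: rt_step; exists r; split.
- exact: rt_refl.
exact: rt_trans zy yx.
Qed.

Definition tails F S A := [seq behead s | s <- S & head F s == A].

Lemma covers_notin_flag F A B r : cov F A -> cov F B -> flag_over B r ->
  A \notin r.
Proof.
move=> /and3P[_ _ /eqP rA] /and3P[fB _ /eqP rB] fr; apply/negP => Ar.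
by have := rank_flat_lt fB (flag_mem_proper fr Ar); rewrite rA rB ltnn.
Qed.

(** A ridge [A :: r] lies in no deleted flag that avoids [A], so the star of [A]
    is affected by the deleted flags through [A] only. *)
Lemma flag_linked_cons k F S A x y : corank F k.+2 -> cov F A ->
  (forall s, s \in S -> flag_over F s /\ size s = k.+2) ->
  flag_linked k A (tails F S A) x y -> flag_linked k.+1 F S (A :: x) (A :: y).
Proof.
move=> cF cA SP; elim=> {x y} [x y|x|x y z _ + _]; last first.
- exact: rt_trans.
- exact: rt_refl.
move=> [r [[fx sx fy sy] [fr sr] rx ry rS]]; apply: rt_step; exists (A :: r).
have sub_cons z : {subset r <= z} -> {subset A :: r <= A :: z}.
  by move=> rz B; rewrite !inE => /orP[->//|/rz->]; rewrite orbT.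
split; rewrite /= ?sr ?sx ?sy; [| |exact: sub_cons|exact: sub_cons|].
- by split=> //; rewrite full_flag_cons ?sx ?sy ?cA.
- have /and3P[fA pA _] := cA.
  by split=> //; rewrite flag_cons fA pA.
move=> s sS rs; have [fs ss] := SP s sS.
case: s => // B s in sS rs fs ss; have [ss'] := ss.
move: fs; rewrite full_flag_cons ?ss' // => /andP[cB fs].
have eAB : B = A.
  have := rs A (mem_head _ _); rewrite inE => /orP[/eqP//|As].
  by have := covers_notin_flag cA cB fs; rewrite As.
subst B; apply: (rS s).
  by apply/mapP; exists (A :: s); rewrite // mem_filter /= eqxx.
move=> C Cr; have := rs C; rewrite !inE Cr orbT => /(_ isT) /orP[/eqP eC|//].
by have := flag_mem_proper fr Cr; rewrite eC properxx.
Qed.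

(** Deleting the first member of a flag is the only way to get a ridge that
    skips the first rank: [A] is not in [r], as it has the rank of [B], which is
    below all members of [r]. *)
Lemma tail_ridge F A B s r : cov F A -> cov F B -> flag_over A s ->
  flag_over B r -> size s <= size r -> {subset r <= A :: s} -> s = r.
Proof.
move=> cA cB fs fr hs rs; apply: (flag_eq fs fr hs) => C Cr.
have := rs C Cr; rewrite inE => /orP[/eqP eC|//].
by have := covers_notin_flag cA cB fr; rewrite -eC Cr.
Qed.

Section Deletion.
Variables (k : nat) (F : {set T}) (S : seq (seq {set T})).
Hypothesis cF : corank F k.+2.
Hypothesis SP : forall s, s \in S -> flag_over F s /\ size s = k.+2.
Hypothesis sizeS : size S <= k.+1.

Lemma flag_head A r : size r = k.+1 -> flag_over F (A :: r) ->
  cov F A /\ flag_over A r.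
Proof. by move=> sr; rewrite full_flag_cons ?sr// => /andP[]. Qed.

Lemma flag_adj_tail A B r : cov F A -> cov F B ->
  flag_over A r -> flag_over B r -> size r = k.+1 ->
  r \notin map behead S -> flag_adj k.+1 F S (A :: r) (B :: r).
Proof.
move=> cA cB fA fB sr rS; have /and3P[_ pFA _] := cA; exists r; split.
- by split; rewrite /= ?sr // full_flag_cons ?sr // ?cA ?cB.
- split=> //; case: r sr {rS} fA fB => // C r' _ + _.
  by rewrite !flag_cons => /and3P[-> pAC ->]; rewrite (proper_trans pFA pAC).
- by move=> C Cr; rewrite inE Cr orbT.
- by move=> C Cr; rewrite inE Cr orbT.
move=> s sS rs; have [fs] := SP sS; case: s => // C s in sS rs fs * => -[ss].
have [cC fCs] := flag_head ss fs.
have es : s = r by apply: (tail_ridge cC cA fCs fA) => //; rewrite ss sr.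
by case/negP: rS; apply/mapP; exists (C :: s).
Qed.

(** Some ridge that starts with [L] is in no deleted flag: by [tail_ridge], this
    concerns only the tails of the deleted flags. *)
Definition free_line L := exists z,
  [/\ flag_over L z, size z = k & L :: z \notin map behead S].

(** At least [k.+1] ridges start with each of the two lines, which makes more
    than [k.+1] ridges, and the tail of a deleted flag is just one of them. *)
Lemma free_line_or L1 L2 : corank L1 k -> corank L2 k -> L1 != L2 ->
  free_line L1 \/ free_line L2.
Proof.
move=> c1 c2 n12.
have [Z1 [u1 s1 Z1P]] := many_full_flags c1.
have [Z2 [u2 s2 Z2P]] := many_full_flags c2.
pose W := map (cons L1) Z1 ++ map (cons L2) Z2.
have uW : uniq W.
  rewrite cat_uniq !map_inj_uniq ?u1 ?u2 ?andbT /=; try by move=> ? ? [].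
  apply/hasPn => _ /mapP[z _ ->]; apply/mapP => -[y _ [e12 _]].
  by rewrite e12 eqxx in n12.
have /allPn[w] : ~~ all (mem (map behead S)) W.
  apply/negP => /allP /(uniq_leq_size uW).
  rewrite size_cat !size_map s1 s2 => /leq_trans /(_ sizeS).
  by rewrite addSn ltnS -[X in _ <= X]addn0 leq_add2l.
rewrite mem_cat => /orP[] /mapP[z Zz ->] wS; [left|right]; exists z.
  by have [] := Z1P z Zz.
by have [] := Z2P z Zz.
Qed.

(** Few enough deletions to apply the induction hypothesis above [A]. *)
Definition good_cover A := size (tails F S A) <= k.

(** At most [k.+1] flags are deleted, so a bad cover carries all of them. *)
Lemma badP A : ~~ good_cover A -> forall s, s \in S -> head F s = A.
Proof.
rewrite /good_cover size_map size_filter -ltnNge => h s sS.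
have : all (fun s => head F s == A) S.
  by rewrite all_count eqn_leq count_size (leq_trans sizeS).
by move=> /allP/(_ s sS)/eqP.
Qed.

(** All the deleted flags pass through the bad cover, hence none of them through
    a line that this cover is not below. *)
Lemma off_line_free A L : ~~ good_cover A -> ~~ (A \subset L) -> corank L k ->
  free_line L.
Proof.
move=> bA nAL cL; have [z fz sz] := full_flag_exists cL; exists z; split=> //.
apply/mapP => -[s sS es]; have hs := badP bA sS; have [fs ss] := SP sS.
case: s => // B s in sS es hs fs ss; move: hs es fs => /= -> <-.
rewrite flag_cons => /and3P[_ _]; rewrite flag_cons => /and3P[_ pAL _].
by rewrite proper_sub in nAL.
Qed.

Hypothesis star_linked : forall A x y, cov F A -> good_cover A ->
  flag_over A x -> size x = k.+1 -> A :: x \notin S ->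
  flag_over A y -> size y = k.+1 -> A :: y \notin S ->
  flag_linked k.+1 F S (A :: x) (A :: y).

Lemma good_linked_line A B L x y : cov F A -> good_cover A ->
  cov F B -> good_cover B ->
  cov A L -> cov B L -> free_line L ->
  flag_over A x -> size x = k.+1 -> A :: x \notin S ->
  flag_over B y -> size y = k.+1 -> B :: y \notin S ->
  flag_linked k.+1 F S (A :: x) (B :: y).
Proof.
move=> cA gA cB gB cAL cBL [z [fz sz zS]] fx sx xS fy sy yS.
have fl C : cov C L -> flag_over C (L :: z).
  by move=> /and3P[fL pCL _]; rewrite flag_cons fL pCL.
have ns C : C :: L :: z \notin S.
  by apply: contra zS => zS; apply/mapP; exists (C :: L :: z).
have sz1 : size (L :: z) = k.+1 by rewrite /= sz.
apply: rt_trans (star_linked cA gA fx sx xS (fl _ cAL) sz1 (ns A)) _.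
apply: rt_trans (star_linked cB gB (fl _ cBL) sz1 (ns B) fy sy yS).
by apply: rt_step; apply: flag_adj_tail => //; apply: fl.
Qed.

Lemma free_line_flag B L : cov B L -> free_line L ->
  exists x, [/\ flag_over B x, size x = k.+1 & B :: x \notin S].
Proof.
move=> /and3P[fL pBL _] [z [fz sz zS]]; exists (L :: z).
split; rewrite /= ?sz// ?flag_cons ?fL ?pBL//.
by apply: contra zS => zS; apply/mapP; exists (B :: L :: z).
Qed.

(** When the line [L] of [A] and [B] is not free, every other line is, and the
    path goes through a cover [E] that is not below [L]. *)
Lemma good_linked A B x y : cov F A -> good_cover A ->
  cov F B -> good_cover B ->
  flag_over A x -> size x = k.+1 -> A :: x \notin S ->
  flag_over B y -> size y = k.+1 -> B :: y \notin S ->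
  flag_linked k.+1 F S (A :: x) (B :: y).
Proof.
move=> cA gA cB gB fx sx xS fy sy yS; have [eAB|nAB] := eqVneq A B.
  by subst B; apply: star_linked.
have /andP[fF _] := cF; have cFA := corank_covers cF cA.
have [L cAL cBL] := covers_join fF cA cB nAB.
have cL := corank_covers cFA cAL.
have [|nfL] := pselect (free_line L).
  by move=> fL; apply: (good_linked_line cA gA cB gB cAL cBL fL).
have /and3P[_ pFA _] := cA; have /and3P[_ pAL _] := cAL.
have pBL : B \proper L by case/and3P: cBL.
have [E cE nEL] := covers_off cF (corank_rank_lt cL)
  (subset_trans (proper_sub pFA) (proper_sub pAL)).
have off (C : {set T}) : C \proper L -> C != E.
  by move=> /proper_sub sCL; apply: contraNneq nEL => <-.
have gE : good_cover E.
  by apply/negPn/negP => bE; apply: nfL; apply: off_line_free bE nEL cL.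
have free (C L' : {set T}) : cov F C -> cov C L' -> cov E L' -> free_line L'.
  move=> cC cCL' cEL'; have nL : L != L'.
    by apply: contraNneq nEL => ->; case/and3P: cEL' => _ /proper_sub.
  by have [] := free_line_or cL (corank_covers (corank_covers cF cC) cCL') nL.
have [L1 cAL1 cEL1] := covers_join fF cA cE (off A pAL).
have [L2 cBL2 cEL2] := covers_join fF cB cE (off B pBL).
have fL1 := free A L1 cA cAL1 cEL1; have fL2 := free B L2 cB cBL2 cEL2.
have [w [fw sw wS]] := free_line_flag cEL1 fL1.
apply: (rt_trans _ _ _ (E :: w)).
  exact: (good_linked_line cA gA cE gE cAL1 cEL1 fL1).
exact: (good_linked_line cE gE cB gB cEL2 cBL2 fL2).
Qed.

(** Over a bad cover, the ridge obtained by removing the first member of a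
    surviving flag is in no deleted flag: each deleted flag passes through the
    bad cover, and would coincide with the surviving flag if it contained that
    ridge. *)
Lemma reach_good A x : cov F A -> flag_over A x ->
  size x = k.+1 -> A :: x \notin S ->
  exists B y, [/\ cov F B /\ good_cover B, flag_over B y, size y = k.+1,
    B :: y \notin S & flag_linked k.+1 F S (A :: x) (B :: y)].
Proof.
move=> cA fx sx xS; have [gA|bA] := boolP (good_cover A).
  by exists A, x; split=> //; apply: rt_refl.
case: x => // L z in fx sx xS *; have [sz] := sx.
have cFA := corank_covers cF cA; have /and3P[fA pFA _] := cA.
have /andP[cAL fz] : cov A L && flag_over L z by rewrite -full_flag_cons ?sz.
have /and3P[fL pAL _] := cAL; have /properP[_ [b bL bA']] := pAL.
have /andP[fF _] := cF.
have [B [cB bB Bmin]] :=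
  covers_through fF (contra (subsetP (proper_sub pFA) b) bA').
have nAB : B != A by apply: contraNneq bA' => <-.
have cBL : cov B L.
  apply: (covers_line cA cAL cB); apply: Bmin => //.
  exact/proper_sub/(proper_trans pFA pAL).
have fB : flag_over B (L :: z).
  by rewrite full_flag_cons ?sz ?(corank_covers cF) ?cBL.
have hS := badP bA.
have LS : L :: z \notin map behead S.
  apply: contra xS => /mapP[s sS es]; have := hS s sS.
  by case: s sS es => // C s sS /= -> <-.
exists B, (L :: z); split=> //.
- split=> //; apply/negPn/negP => /badP hB.
  have : S != [::] by apply/eqP => S0; move: bA; rewrite /good_cover S0.
  case: (S) hS hB => // s S' hS hB _.
  by move: nAB; rewrite -(hB s) ?mem_head // hS ?mem_head ?eqxx.
- by apply: contra LS => zS; apply/mapP; exists (B :: L :: z).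
apply: rt_step; apply: flag_adj_tail => //.
Qed.
End Deletion.

(** For [k = 0] nothing is deleted, and the empty ridge joins all flags of one
    member. *)
Theorem full_flags_linked k F S x y : corank F k.+1 -> size S <= k ->
  (forall s, s \in S -> flag_over F s /\ size s = k.+1) ->
  flag_over F x -> size x = k.+1 -> x \notin S ->
  flag_over F y -> size y = k.+1 -> y \notin S -> flag_linked k F S x y.
Proof.
elim: k F S x y => [|k IHk] F S x y cF hS SP fx sx xS fy sy yS.
  case: S hS {SP xS yS} => // _; apply: rt_step; exists [::]; split=> //.
  split=> //; rewrite /flag_over /= andbT properEneq subsetT andbT.
  by apply: contraTneq (corank_rank_lt cF) => ->; rewrite ltnn.
have star A u v : cov F A -> good_cover k F S A ->
    flag_over A u -> size u = k.+1 -> A :: u \notin S ->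
    flag_over A v -> size v = k.+1 -> A :: v \notin S ->
    flag_linked k.+1 F S (A :: u) (A :: v).
  move=> cA gA fu su uS fv sv vS.
  have /and3P[_ pFA _] := cA.
  have tailS w : A :: w \notin S -> w \notin tails F S A.
    apply: contra => /mapP[s]; rewrite mem_filter => /andP[/eqP hs sS] ->.
    have [_] := SP s sS; case: s hs sS => // B s /= -> sS _.
    exact: sS.
  apply: flag_linked_cons => //.
  apply: IHk => //; [exact: corank_covers cF cA| |exact: tailS|exact: tailS].
  move=> w /mapP[s]; rewrite mem_filter => /andP[/eqP hs sS] ->.
  have [] := SP s sS; case: s hs {sS} => // B s /= -> + [ss].
  by rewrite full_flag_cons ?ss // => /andP[].
case: x fx sx xS => // A x fx [sx] xS; case: y fy sy yS => // B y fy [sy] yS.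
have [cA fAx] := flag_head cF sx fx; have [cB fBy] := flag_head cF sy fy.
have [A' [x' [[cA' gA'] fx' sx' xS' lx]]] := reach_good cF SP hS cA fAx sx xS.
have [B' [y' [[cB' gB'] fy' sy' yS' ly]]] := reach_good cF SP hS cB fBy sy yS.
apply: rt_trans lx (rt_trans _ _ _ _ _ _ (flag_linked_sym ly)).
exact: (good_linked cF SP hS star).
Qed.
End Flags.

(** * The cones of the fine subdivision *)

Import GRing.Theory Num.Theory Order.TTheory.
Local Open Scope ring_scope.

Section ChainCones.
Import fintype boot.finset.
Variables (R : realType) (n : nat) (M : matroid 'I_n.+1).
Implicit Types (F G : {set 'I_n.+1}) (c r : seq {set 'I_n.+1}).
Local Notation flag_over := (flag_over M).
Local Notation cone := (@chain_cone R n).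

HB.instance Definition _ := GRing.isLinear.Build R _ _ _ (@quot1 R n)
  (@quot1_linear R n).

Lemma e_E F j : e_ R F ord0 j = (j \in F)%:R.
Proof.
rewrite /e_ summxE; case: (boolP (j \in F)) => jF.
  rewrite (bigD1 j) //= mxE !eqxx big1 ?addr0 // => i /andP[_ /negbTE nij].
  by rewrite mxE eq_sym nij andbF.
rewrite big1 // => i iF; rewrite mxE eqxx /=.
by case: eqP => // eji; rewrite eji iF in jF.
Qed.

Lemma flag_outside F c : flag_over F c ->
  exists2 t, t \notin F & forall G, G \in c -> t \notin G.
Proof.
elim: c F => [|A c IHc] F.
  by rewrite /flag_over /= andbT => /properP[_ [t _ tF]]; exists t.
rewrite flag_cons => /and3P[_ /proper_sub sFA /IHc[t tA tc]].
exists t; first exact: contra (subsetP sFA t) tA.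
by move=> G; rewrite inE => /orP[/eqP->|/tc].
Qed.

Lemma flag_next F c : flag_over F c ->
  exists2 t, t \notin F & forall G, G \in c -> t \in G.
Proof.
case: c => [|A c].
  by rewrite /flag_over /= andbT => /properP[_ [t _ tF]]; exists t.
rewrite flag_cons => /and3P[_ /properP[_ [t tA tF]] fc]; exists t => // G.
rewrite inE => /orP[/eqP->//|/(flag_mem_proper fc) /proper_sub /subsetP]; exact.
Qed.

Lemma flag_comparable F c G G' : flag_over F c -> G \in c -> G' \in c ->
  (G \subset G') || (G' \subset G).
Proof.
elim: c F => // A c IHc F; rewrite flag_cons => /and3P[_ _ fc].
rewrite !inE => /orP[/eqP->|Gc] /orP[/eqP->|G'c]; rewrite ?subxx //.
- by rewrite proper_sub ?(flag_mem_proper fc G'c).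
- by rewrite orbC proper_sub ?(flag_mem_proper fc Gc).
exact: IHc fc Gc G'c.
Qed.

Definition ray_comb c (a : {set 'I_n.+1} -> R) := \sum_(F <- c) a F *: e_ R F.

Lemma ray_combE c a j : ray_comb c a ord0 j = \sum_(F <- c | j \in F) a F.
Proof.
rewrite /ray_comb summxE [RHS]big_mkcond; apply: eq_bigr => F _.
by rewrite mxE e_E; case: ifP; rewrite (mulr1, mulr0).
Qed.

(** Indexing the coefficients by the sets rather than by positions makes it
    possible to compare the cones over different chains. *)
Lemma chain_coneP c v : uniq c -> cone c v <->
  exists2 a, forall F, 0 <= a F & v = quot1 (ray_comb c a).
Proof.
move=> uc; pose X := [seq e_ R F | F <- c].
have sumX (b : {set 'I_n.+1} -> R) :
    \sum_(i < size X) b (nth finset.set0 c i) *: X`_i = ray_comb c b.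
  rewrite -(big_mkord xpredT (fun i => b (nth finset.set0 c i) *: X`_i)).
  rewrite size_map /ray_comb [RHS](big_nth finset.set0) !big_mkord.
  by apply: eq_bigr => i _; rewrite (nth_map finset.set0).
split=> [[_ [a a0 ->] <-]|[a a0 ->]]; last first.
  exists (ray_comb c a) => //.
  by exists (fun i : 'I__ => a (nth finset.set0 c i)) => [i|]; rewrite ?sumX.
exists (fun F => oapp a 0 (insub (index F c))) => [F|].
  by case: insubP => //= i _ _.
rewrite -sumX; congr quot1; apply: eq_bigr => i _; congr (_ *: _).
have ic : (i < size c)%N by have := ltn_ord i; rewrite [X in (_ < X)%N]size_map.
by rewrite index_uniq // valK.
Qed.

Lemma ray_in_chain_cone c F : uniq c -> F \in c -> cone c (quot1 (e_ R F)).
Proof.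
move=> uc Fc; apply/(chain_coneP _ uc); exists (fun G => (G == F)%:R) => //.
rewrite /ray_comb (bigD1_seq F)//= eqxx scale1r big1 ?addr0 // => G /negbTE->.
by rewrite scale0r.
Qed.

Lemma chain_coneS r c : uniq r -> uniq c -> {subset r <= c} ->
  (cone r `<=` cone c)%classic.
Proof.
move=> ur uc rc v /(chain_coneP _ ur)[a a0 ->]; apply/(chain_coneP _ uc).
exists (fun F => if F \in r then a F else 0) => [F|]; first by case: ifP.
congr quot1; have pr : perm_eq r [seq F <- c | F \in r].
  apply: uniq_perm => //; first exact: filter_uniq.
  by move=> F; rewrite mem_filter; case: (boolP (F \in r)) => // /rc ->.
rewrite /ray_comb (perm_big _ pr) big_filter [LHS]big_mkcond.
by apply: eq_bigr => F _; case: ifP; rewrite ?scale0r.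
Qed.

(** Lift the points of the cone to vectors [ray_comb c a] with [a] nonnegative.
    If such a vector differs from [e_ R F] by a multiple of the all-ones vector,
    then this multiple is zero: [ray_comb c a] vanishes at a point outside all
    members of [c], and that point cannot be in [F].  Hence [F] is the union of
    the members of [c] with a positive coefficient, that is, the largest of
    them. *)
Lemma chain_cone_ray c F : flag_over finset.set0 c -> F != finset.set0 ->
  F \proper [set: 'I_n.+1]%SET -> cone c (quot1 (e_ R F)) -> F \in c.
Proof.
move=> fc F0 /properP[_ [y _ yF]].
have /andP[_ uc] := flag_uniq fc; case/(chain_coneP _ uc) => a a0 eF.
have [l /rowP el] : exists l : R, e_ R F - ray_comb c a = l *: const_mx 1.
  by apply/quot1_eq0; rewrite linearB /= eF subrr.
have {}el j : (j \in F)%:R - \sum_(G <- c | j \in G) a G = l.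
  by have := el j; rewrite !mxE mulr1 e_E ray_combE.
have l0 : l = 0.
  have [t _ tc] := flag_outside fc.
  have := el t; rewrite big_seq_cond big1 => [|G /andP[/tc/negbTE->]//].
  rewrite subr0; case: (t \in F) => // l1.
  have := el y; rewrite (negbTE yF) -l1 sub0r => e1.
  have : 0 <= - (true%:R : R) by rewrite -e1 opprK sumr_ge0.
  by rewrite oppr_ge0 ler10.
have {el}sumF j : \sum_(G <- c | j \in G) a G = (j \in F)%:R.
  by apply/esym/eqP; rewrite -subr_eq0 el l0.
have pos_mem j : j \in F -> exists2 G, (G \in c) && (0 < a G) & j \in G.
  move=> jF; have : \sum_(G <- c | j \in G) a G != 0 by rewrite sumF jF oner_eq0.
  rewrite psumr_neq0 // => /hasP[G Gc /andP[jG aG]].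
  by exists G; rewrite // Gc.
have [x /pos_mem[G0 PG0 _]] := set0Pn _ F0.
case: (arg_maxnP (P := fun G => (G \in c) && (0 < a G))
  (fun G : {set 'I_n.+1} => #|G|) PG0) => G /andP[Gc aG] Gmax.
suff -> : F = G by [].
apply/eqP; rewrite eqEsubset; apply/andP; split; apply/subsetP => j jG.
  have [G' /[dup] /Gmax /= leG /andP[G'c _] jG'] := pos_mem j jG.
  have /orP[sG|/subsetP->//] := flag_comparable fc Gc G'c.
  by have /eqP -> : G == G' by rewrite eqEcard sG.
apply/negPn/negP => /negbTE jF; have := sumF j; rewrite jF => /eqP.
rewrite psumr_eq0// => /allP /(_ G Gc); rewrite jG /=.
by rewrite gt_eqF.
Qed.

(** The ray of the first member [A] is not in the span of the others: for [x] in
    [A] but not in [F], and [y] outside [A] but in all later members, the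
    coordinates at [x] and [y] agree on the lifts of the others, and this is
    preserved by adding multiples of the all-ones vector. *)
Lemma free_rays F c : flag_over F c -> free [seq quot1 (e_ R G) | G <- c].
Proof.
elim: c F => [|A c IHc] F /=; first by rewrite nil_free.
rewrite flag_cons => /and3P[_ /properP[_ [x xA xF]] fc].
rewrite free_cons (IHc _ fc) andbT; apply/negP => vX.
pose X := in_tuple [seq quot1 (e_ R G) | G <- c].
have ev := @coord_span _ _ _ X _ vX; set v := quot1 _ in ev.
have [y yA yc] := flag_next fc.
pose w := \sum_(i < size [seq quot1 (e_ R G) | G <- c])
  coord X i v *: e_ R (nth finset.set0 c i).
have wxy : w ord0 x = w ord0 y.
  rewrite /w !summxE; apply: eq_bigr => i _; rewrite !mxE !e_E.
  have ic : nth finset.set0 c i \in c.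
    by apply: mem_nth; have := ltn_ord i; rewrite [X in (_ < X)%N]size_map.
  by rewrite yc // (subsetP (proper_sub (flag_mem_proper fc ic))).
have [l /rowP el] : exists l : R, e_ R A - w = l *: const_mx 1.
  apply/quot1_eq0; rewrite linearB /= -/v {1}ev /w linear_sum /=.
  apply/eqP; rewrite subr_eq0; apply/eqP/eq_bigr => i _; rewrite linearZ /=.
  congr (_ *: _); rewrite (nth_map finset.set0) //.
  by have := ltn_ord i; rewrite [X in (_ < X)%N]size_map.
have := el x; have := el y; rewrite !mxE !e_E xA (negbTE yA) wxy => <- /addIr.
by move=> /eqP; rewrite oner_eq0.
Qed.

Lemma cone_dim_chain c : flag_over finset.set0 c -> cone_dim (cone c) = size c.
Proof.
move=> fc; have /andP[_ uc] := flag_uniq fc.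
have := free_rays fc; set X := map _ c => fX.
have [CU Umin] := lin_hullP (cone c).
rewrite /cone_dim -(size_map (fun G => quot1 (e_ R G)) c) -/X.
rewrite -(eqP fX); congr (\dim _); apply/eqP; rewrite eqEsubv.
apply/andP; split; last first.
  apply/span_subvP => _ /mapP[G Gc ->]; apply: CU; exact: ray_in_chain_cone.
apply: Umin => _ /(chain_coneP _ uc)[a _ ->].
rewrite /ray_comb linear_sum /= big_seq; apply: memv_suml => G Gc.
rewrite linearZ /=; apply/memvZ/memv_span; exact: map_f.
Qed.
End ChainCones.

(** * From flags to the facet-ridge hypergraph *)

Section Fan.
Import fintype boot.finset.
Variables (R : realType) (n d : nat) (M : matroid 'I_n.+1).
Local Notation cone := (@chain_cone R n).
Local Notation flag := (flag_over M finset.set0).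
Local Notation graph := (facet_ridge_hypergraph d (fine_subdivision R M)).
Local Notation facets := (facets d (fine_subdivision R M)).

(** Without loops the empty set is a flat, hence a base for full flags. *)
Lemma loopless_corank : loopless M -> rank M [set: 'I_n.+1]%SET = d.+1 ->
  corank M finset.set0 d.
Proof.
move=> /forallP lM rM; have r0 : rank M finset.set0 = 0.
  apply/eqP; rewrite -leqn0; apply: rank_le => I _.
  by rewrite subset0 => /eqP->; rewrite cards0.
rewrite /corank r0 rM eqxx andbT; apply/forallP => x; apply/implyP => _.
by rewrite r0 -(cards1 x) indep_le_rank // subsetUl.
Qed.

Lemma facetP C : facets C <->
  loopless M /\ exists c, [/\ flag c, size c = d & C = cone c].
Proof.
split=> [[[lM [c fc ->]]]|[lM [c [fc sc ->]]]].
  by rewrite (cone_dim_chain R fc) => sc; split=> //; exists c.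
by split; [split=> //; exists c | rewrite (cone_dim_chain R fc)].
Qed.

Lemma flag_in_cone c r : flag c -> flag r -> (cone r `<=` cone c)%classic ->
  {subset r <= c}.
Proof.
move=> fc fr sub F Fr; have /andP[_ ur] := flag_uniq fr.
apply: (chain_cone_ray fc).
- by rewrite -proper0 (flag_mem_proper fr Fr).
- exact: flag_mem_properT fr Fr.
- exact/sub/ray_in_chain_cone.
Qed.

(** [L] lists flags of the deleted facets; a hyperedge that meets [S] would give
    a member of [L] containing the ridge [r]. *)
Lemma flag_adj_hadj k L (S : set (set 'rV[R]_n)) c c' : d = k.+1 -> loopless M ->
  (forall C, S C -> exists s, [/\ s \in L, flag s & C = cone s]) ->
  flag_adj M k finset.set0 L c c' -> hadj (hremove graph S) (cone c) (cone c').
Proof.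
move=> dk lM SL [r [[fc sc fc' sc'] [fr sr] rc rc' rL]].
have [/andP[_ uc] /andP[_ uc']] := (flag_uniq fc, flag_uniq fc').
have /andP[_ ur] := flag_uniq fr.
exists [set C | facets C /\ (cone r `<=` C)%classic]%classic; last first.
  split; split; try exact: chain_coneS.
    by apply/facetP; split=> //; exists c; split; rewrite ?dk.
  by apply/facetP; split=> //; exists c'; split; rewrite ?dk.
split.
  exists (cone r) => //; split; last by rewrite (cone_dim_chain R fr) sr dk.
  by split=> //; exists r.
apply/eqP/negPn/negP => /set0P[C [[_ rC] /SL[s [sL fs eC]]]].
by apply: (rL s sL); apply: flag_in_cone; rewrite -?eC.
Qed.
End Fan.

Lemma path_of_linked (T U : Type) (e : rel U) (f : T -> U)
    (a : T -> T -> Prop) x y :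
  (forall u v, a u v -> e (f u) (f v)) -> clos_refl_trans T a x y ->
  exists2 p, path e (f x) p & last (f x) p = f y.
Proof.
move=> ae; elim=> {x y} [x y /ae exy|x|x y z _ [p px py] _ [q qy qz]].
- by exists [:: f y]; rewrite //= exy.
- by exists [::].
by exists (p ++ q); rewrite ?cat_path ?last_cat py // px.
Qed.

Theorem proposition14 (R : realType) (n d : nat) (M : matroid 'I_n.+1)
    (hM : rank M [set: 'I_n.+1]%SET = d.+1) :
  hkconnected d (facet_ridge_hypergraph d (fine_subdivision R M)).
Proof.
move=> S m SV cardS ltmd x y [Vx nSx] [Vy nSy].
have [lM [cx [fx sx ex]]] := (facetP d M x).1 Vx.
have [_ [cy [fy sy ey]]] := (facetP d M y).1 Vy.
case: d => // k in hM SV ltmd Vx Vy sx sy *.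
(* Each deleted facet is replaced by a flag whose cone it is. *)
pose is_flag (C : set 'rV[R]_n) c :=
  [/\ flag_over M finset.set0 c, size c = k.+1 & C = @chain_cone R n c].
pose g C := xget [::] (is_flag C).
have gP C : S C -> is_flag C (g C).
  by move=> /SV/facetP[_ [c hc]]; apply: xgetPex; exists c.
move: cardS; rewrite card_eq_sym => /card_set_bijP[f [fS _ fsurj]].
pose L := [seq g (f i) | i <- iota 0 m].
have SL C : S C -> g C \in L.
  move=> /fsurj[i im <-]; apply/map_f; by rewrite mem_iota.
have LS s : s \in L -> S (chain_cone s) /\ is_flag (chain_cone s) s.
  move=> /mapP[i]; rewrite mem_iota => im ->.
  have Sfi := fS i im; have [h1 h2 eC] := gP _ Sfi.
  by split; [rewrite -eC|split].
rewrite ex ey; apply: (path_of_linked (a := flag_adj M k finset.set0 L)).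
  move=> u v uv; apply/asboolP; apply: flag_adj_hadj uv => // C SC.
  by exists (g C); have [] := gP C SC; split=> //; apply: SL.
apply: full_flags_linked => //.
- exact: loopless_corank.
- by rewrite size_map size_iota.
- by move=> s /LS[_ []].
- by apply/negP => /LS[]; rewrite -ex.
- by apply/negP => /LS[]; rewrite -ey.
Qed.
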